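(* (1) Let $\mathbb C$ be a (Barr-)exact action distinctive Mal'tsev category. Then $\mathbb C$ has enough eccentric objects, i.e. for every split epimorphism $(f,s)$ in $\mathbb C$ there is a $\mathrm P_{\mathbb C}$-cartesian map $(f,s)\rightarrow(g,t)$ in $\mathrm{Pt}\,\mathbb C$ whose codomain $(g,t)$ is eccentric. (2) Let $\mathbb C$ be a (Barr-)exact pointed protomodular category with normalizers. Then $\mathbb C$ is action accessible.
   Context: **Points.** $\mathrm{Pt}\,\mathbb C$ is the category whose objects are split epimorphisms with a given splitting, $(f,s):X\rightleftarrows Y$ with $f\circ s=1_Y$, and whose maps $(f',s')\rightarrow(f,s)$ are pairs $(x:X'\rightarrow X,\ y:Y'\rightarrow Y)$ with $f x=y f'$ and $x s'=s y$. $\mathrm P_{\mathbb C}:\mathrm{Pt}\,\mathbb C\rightarrow\mathbb C$ is the codomain functor; it is a fibration whose cartesian maps are those $(x,y)$ for which the square $fx=yf'$ is a pullback. A category $\mathbb C$ (finitely complete) is *protomodular* if all change of base functors of the fibration $\mathrm P_{\mathbb C}$ are conservative. It is *Mal'tsev* if it is finitely complete and every reflexive relation is an equivalence relation; every pointed protomodular category is Mal'tsev. **Action distinctive.** A Mal'tsev category $\mathbb C$ is *action distinctive* if for any object $(f,s)$ of $\mathrm{Pt}\,\mathbb C$ there is a greatest equivalence relation $\mathbb D[f,s]$ in $\mathrm{Pt}\,\mathbb C$ on $(f,s)$ whose two legs are $\mathrm P_{\mathbb C}$-cartesian maps; it is called the distinctive equivalence relation of $(f,s)$. **Eccentric, faithful,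 accessible.** In an action distinctive Mal'tsev category, $(f,s)$ is *eccentric* when $\mathbb D[f,s]$ is the discrete equivalence relation. In a pointed Mal'tsev category, $(f,s)$ is *faithful* when, for any split epimorphism $(f',s')$, any two parallel $\mathrm P_{\mathbb C}$-cartesian maps $(x_0,y_0),(x_1,y_1):(f',s')\rightarrow(f,s)$ are equal as soon as they induce the same (iso)morphism $K[f']\rightarrow K[f]$ between the kernels. A pointed Mal'tsev category is *action accessible* if for any split epimorphism $(f,s)$ there is a $\mathrm P_{\mathbb C}$-cartesian map $(f,s)\rightarrow(g,t)$ whose codomain is faithful. **Normalizers.** For an equivalence relation $(d_0,d_1):R\rightrightarrows X$, a monomorphism $u:U\rightarrowtail X$ is *normal to* $R$ if $u^{-1}(R)=\nabla_U$ (the indiscrete relation $U\times U$) and the induced internal functor $\nabla_U\rightarrow R$ (given by $u$ and $\tilde u:U\times U\rightarrow R$ with $d_i\tilde u=u p_i$) is a discrete fibration, i.e. these squares are pullbacks. A monomorphism $v:U\rightarrowtail T$ *has a normalizer* when there is a pair $(u,R_v)$, with $u:U\rightarrowtail X$ normal to the equivalence relation $R_v$ on $X$, and a map $w:X\rightarrow T$ with $v=w u$, universal in the sense that for every equivalence relation $S$ on an object $X'$, every $u':U\rightarrowtail X'$ normal to $S$ and every $h:X'\rightarrow T$ with $v=h u'$, there is a unique $h':X'\rightarrow X$ with $w h'=h$, $h'u'=u$ and $h'$ underlying a map of equivalence relations $S\rightarrow R_v$. $\mathbb C$ *has normalizers* when every monomorphism has a normalizer. *)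

(* Defs.v *)
From Stdlib Require Import ProofIrrelevance.

Set Implicit Arguments.
Unset Strict Implicit.
Unset Printing Implicit Defensive.

Declare Scope cat_scope.
Delimit Scope cat_scope with cat.
Open Scope cat_scope.

(** * Categories and functors *)

Record category := Category {
  Ob :> Type;
  Hom : Ob -> Ob -> Type;
  idm : forall X, Hom X X;
  comp : forall X Y Z, Hom Y Z -> Hom X Y -> Hom X Z;
  compA : forall X Y Z T (h : Hom Z T) (g : Hom Y Z) (f : Hom X Y),
    comp h (comp g f) = comp (comp h g) f;
  comp1m : forall X Y (f : Hom X Y), comp (idm Y) f = f;
  compm1 : forall X Y (f : Hom X Y), comp f (idm X) = f
}.

Arguments Hom {c} X Y.
Arguments idm {c} X.
Arguments comp {c X Y Z} g f.

Notation "X ~> Y" := (Hom X Y)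
  (at level 90, right associativity) : cat_scope.
Notation "g ∘ f" := (comp g f)
  (at level 40, left associativity) : cat_scope.

Definition is_iso (C : category) (X Y : C) (f : X ~> Y) : Prop :=
  exists g : Y ~> X, g ∘ f = idm X /\ f ∘ g = idm Y.

Definition is_mono (C : category) (X Y : C) (f : X ~> Y) : Prop :=
  forall (T : C) (a b : T ~> X), f ∘ a = f ∘ b -> a = b.

Record functor (C D : category) := Functor {
  fob :> C -> D;
  fmap : forall X Y : C, (X ~> Y) -> (fob X ~> fob Y);
  fmap1 : forall X : C, fmap (idm X) = idm (fob X);
  fmapM : forall (X Y Z : C) (g : Y ~> Z) (f : X ~> Y),
    fmap (g ∘ f) = fmap g ∘ fmap f
}.

Definition conservative (C D : category) (F : functor C D) : Prop :=
  forall (X Y : C) (f : X ~> Y), is_iso (fmap F f) -> is_iso f.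

(** * Limits and colimits *)

Definition is_terminal (C : category) (Z : C) : Prop :=
  forall X : C, exists! f : X ~> Z, True.

Definition is_initial (C : category) (Z : C) : Prop :=
  forall X : C, exists! f : Z ~> X, True.

Definition is_zero (C : category) (Z : C) : Prop :=
  is_terminal Z /\ is_initial Z.

Definition pointed (C : category) : Prop := exists Z : C, is_zero Z.

Definition is_product (C : category) (A B W : C)
    (p0 : W ~> A) (p1 : W ~> B) : Prop :=
  forall (T : C) (a : T ~> A) (b : T ~> B),
    exists! t : T ~> W, p0 ∘ t = a /\ p1 ∘ t = b.

(** The square [f ∘ a = g ∘ b] is a pullback:
<<
      P --a--> A
      |        |
      b        f
      v        v
      B --g--> Z
>> *)
Definition is_pullback (C : category) (P A B Z : C)
    (a : P ~> A) (b : P ~> B) (f : A ~> Z) (g : B ~> Z) : Prop :=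
  f ∘ a = g ∘ b /\
  forall (T : C) (u : T ~> A) (v : T ~> B), f ∘ u = g ∘ v ->
    exists! t : T ~> P, a ∘ t = u /\ b ∘ t = v.

Definition finitely_complete (C : category) : Prop :=
  (exists Z : C, is_terminal Z) /\
  (forall (A B Z : C) (f : A ~> Z) (g : B ~> Z),
     exists (P : C) (a : P ~> A) (b : P ~> B), is_pullback a b f g).

Definition is_kernel_pair (C : category) (R X Y : C)
    (p0 p1 : R ~> X) (f : X ~> Y) : Prop :=
  is_pullback p0 p1 f f.

Definition is_coequalizer (C : category) (R X Q : C)
    (a b : R ~> X) (q : X ~> Q) : Prop :=
  q ∘ a = q ∘ b /\
  forall (T : C) (t : X ~> T), t ∘ a = t ∘ b -> exists! r : Q ~> T, r ∘ q = t.

Definition regular_epi (C : category) (X Q : C) (q : X ~> Q) : Prop :=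
  exists (R : C) (a b : R ~> X), is_coequalizer a b q.

(** [k] is the kernel of [f], i.e. the pullback of [0 ~> Y] along [f]. *)
Definition is_kernel (C : category) (K X Y : C)
    (k : K ~> X) (f : X ~> Y) : Prop :=
  exists (Z : C) (a : K ~> Z) (b : Z ~> Y), is_zero Z /\ is_pullback k a f b.

(** * Internal relations *)

Record relation (C : category) (X : C) := Relation {
  rel_ob :> C;
  d0 : rel_ob ~> X;
  d1 : rel_ob ~> X;
  rel_monic : forall (T : C) (a b : T ~> rel_ob),
    d0 ∘ a = d0 ∘ b -> d1 ∘ a = d1 ∘ b -> a = b
}.

Arguments d0 {C X} r.
Arguments d1 {C X} r.

Definition rel_reflexive (C : category) (X : C) (R : relation X) : Prop :=
  exists r : X ~> R, d0 R ∘ r = idm X /\ d1 R ∘ r = idm X.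

Definition rel_symmetric (C : category) (X : C) (R : relation X) : Prop :=
  exists r : R ~> R, d0 R ∘ r = d1 R /\ d1 R ∘ r = d0 R.

Definition rel_transitive (C : category) (X : C) (R : relation X) : Prop :=
  forall (T : C) (a b : T ~> R), d1 R ∘ a = d0 R ∘ b ->
    exists c : T ~> R, d0 R ∘ c = d0 R ∘ a /\ d1 R ∘ c = d1 R ∘ b.

Definition is_equivalence (C : category) (X : C) (R : relation X) : Prop :=
  rel_reflexive R /\ rel_symmetric R /\ rel_transitive R.

Definition rel_map (C : category) (X Y : C) (R : relation X) (S : relation Y)
    (h : X ~> Y) : Prop :=
  exists m : R ~> S, d0 S ∘ m = h ∘ d0 R /\ d1 S ∘ m = h ∘ d1 R.

Definition rel_le (C : category) (X : C) (R S : relation X) : Prop :=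
  exists m : R ~> S, d0 S ∘ m = d0 R /\ d1 S ∘ m = d1 R.

Definition rel_eq (C : category) (X : C) (R S : relation X) : Prop :=
  rel_le R S /\ rel_le S R.

Definition discrete_rel (C : category) (X : C) : relation X.
Proof.
refine (@Relation C X X (idm X) (idm X) _).
intros T a b H _; rewrite !comp1m in H; exact H.
Defined.

(** [∇_U], computed from any product [U × U]. *)
Definition indiscrete_rel (C : category) (U W : C) (p0 p1 : W ~> U)
    (HW : is_product p0 p1) : relation U.
Proof.
refine (@Relation C U W p0 p1 _).
intros T a b H0 H1.
destruct (HW T (p0 ∘ b) (p1 ∘ b)) as [t [_ Ht]].
rewrite <- (Ht a (conj H0 H1)); apply Ht; split; reflexivity.
Defined.

(** [S = u^{-1}(R)], with [m] the comparison map: the joint pullback of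
    [(d0, d1) : R ~> X × X] along [u × u]. *)
Definition is_inverse_image (C : category) (U X : C) (u : U ~> X)
    (R : relation X) (S : relation U) (m : S ~> R) : Prop :=
  d0 R ∘ m = u ∘ d0 S /\ d1 R ∘ m = u ∘ d1 S /\
  forall (T : C) (a b : T ~> U) (r : T ~> R),
    d0 R ∘ r = u ∘ a -> d1 R ∘ r = u ∘ b ->
    exists! t : T ~> S, d0 S ∘ t = a /\ d1 S ∘ t = b /\ m ∘ t = r.

(** * Mal'tsev and exact categories *)

Definition maltsev (C : category) : Prop :=
  finitely_complete C /\
  forall (X : C) (R : relation X), rel_reflexive R -> is_equivalence R.

Definition regular_category (C : category) : Prop :=
  finitely_complete C /\
  (forall (R X Y : C) (p0 p1 : R ~> X) (f : X ~> Y), is_kernel_pair p0 p1 f ->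
     exists (Q : C) (q : X ~> Q), is_coequalizer p0 p1 q) /\
  (forall (P A B Z : C) (a : P ~> A) (b : P ~> B) (f : A ~> Z) (g : B ~> Z),
     is_pullback a b f g -> regular_epi f -> regular_epi b).

Definition barr_exact (C : category) : Prop :=
  regular_category C /\
  forall (X : C) (R : relation X), is_equivalence R ->
    exists (Y : C) (f : X ~> Y), is_kernel_pair (d0 R) (d1 R) f.

(** * The category of points *)

Record point (C : category) := Point {
  pt_dom : C;
  pt_cod : C;
  pt_epi : pt_dom ~> pt_cod;
  pt_sec : pt_cod ~> pt_dom;
  pt_split : pt_epi ∘ pt_sec = idm pt_cod
}.

Record point_map (C : category) (p q : point C) := PointMap {
  pm_dom : pt_dom p ~> pt_dom q;
  pm_cod : pt_cod p ~> pt_cod q;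
  pm_epi : pt_epi q ∘ pm_dom = pm_cod ∘ pt_epi p;
  pm_sec : pm_dom ∘ pt_sec p = pt_sec q ∘ pm_cod
}.

Lemma point_map_eq (C : category) (p q : point C) (m n : point_map p q) :
  pm_dom m = pm_dom n -> pm_cod m = pm_cod n -> m = n.
Proof.
destruct m as [x y e s], n as [x' y' e' s']; simpl; intros; subst.
f_equal; apply proof_irrelevance.
Qed.

Definition point_id (C : category) (p : point C) : point_map p p.
Proof.
refine (@PointMap C p p (idm _) (idm _) _ _).
- rewrite compm1, comp1m; reflexivity.
- rewrite compm1, comp1m; reflexivity.
Defined.

Definition point_comp (C : category) (p q r : point C)
    (n : point_map q r) (m : point_map p q) : point_map p r.
Proof.
refine (@PointMap C p r (pm_dom n ∘ pm_dom m) (pm_cod n ∘ pm_cod m) _ _).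
- rewrite compA, pm_epi, <- compA, pm_epi, compA; reflexivity.
- rewrite <- compA, pm_sec, compA, pm_sec, compA; reflexivity.
Defined.

Definition Pt (C : category) : category.
Proof.
refine (@Category (point C) (@point_map C) (@point_id C) (@point_comp C) _ _ _).
- intros; apply point_map_eq; apply compA.
- intros; apply point_map_eq; apply comp1m.
- intros; apply point_map_eq; apply compm1.
Defined.

(** Cartesian maps of the codomain fibration [Pt C -> C]. *)
Definition cartesian (C : category) (p q : Pt C) (m : p ~> q) : Prop :=
  is_pullback (pm_dom m) (pt_epi p) (pt_epi q) (pm_cod m).

(** * Protomodularity *)

(** [PtOver Y] is the fibre over [Y] of the codomain fibration [Pt C -> C]. *)
Record point_over (C : category) (Y : C) := PointOver {
  po_dom : C;
  po_epi : po_dom ~> Y;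
  po_sec : Y ~> po_dom;
  po_split : po_epi ∘ po_sec = idm Y
}.

Record point_over_map (C : category) (Y : C) (p q : point_over Y) :=
PointOverMap {
  pom :> po_dom p ~> po_dom q;
  pom_epi : po_epi q ∘ pom = po_epi p;
  pom_sec : pom ∘ po_sec p = po_sec q
}.

Lemma point_over_map_eq (C : category) (Y : C) (p q : point_over Y)
    (m n : point_over_map p q) : pom m = pom n -> m = n.
Proof.
destruct m as [x e s], n as [x' e' s']; simpl; intros; subst.
f_equal; apply proof_irrelevance.
Qed.

Definition point_over_id (C : category) (Y : C) (p : point_over Y) :
  point_over_map p p.
Proof.
refine (@PointOverMap C Y p p (idm _) _ _).
- apply compm1.
- apply comp1m.
Defined.

Definition point_over_comp (C : category) (Y : C) (p q r : point_over Y)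
    (n : point_over_map q r) (m : point_over_map p q) : point_over_map p r.
Proof.
refine (@PointOverMap C Y p r (pom n ∘ pom m) _ _).
- rewrite compA, pom_epi, pom_epi; reflexivity.
- rewrite <- compA, pom_sec, pom_sec; reflexivity.
Defined.

Definition PtOver (C : category) (Y : C) : category.
Proof.
refine (@Category (point_over Y) (@point_over_map C Y) (@point_over_id C Y)
          (@point_over_comp C Y) _ _ _).
- intros; apply point_over_map_eq; apply compA.
- intros; apply point_over_map_eq; apply comp1m.
- intros; apply point_over_map_eq; apply compm1.
Defined.

Record pullback (C : category) (A B Z : C) (f : A ~> Z) (g : B ~> Z) :=
Pullback {
  pb_ob : C;
  pb1 : pb_ob ~> A;
  pb2 : pb_ob ~> B;
  pb_comm : f ∘ pb1 = g ∘ pb2;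
  pb_lift : forall (T : C) (u : T ~> A) (v : T ~> B),
    f ∘ u = g ∘ v -> (T ~> pb_ob);
  pb_lift1 : forall (T : C) (u : T ~> A) (v : T ~> B) (H : f ∘ u = g ∘ v),
    pb1 ∘ pb_lift H = u;
  pb_lift2 : forall (T : C) (u : T ~> A) (v : T ~> B) (H : f ∘ u = g ∘ v),
    pb2 ∘ pb_lift H = v;
  pb_monic : forall (T : C) (s t : T ~> pb_ob),
    pb1 ∘ s = pb1 ∘ t -> pb2 ∘ s = pb2 ∘ t -> s = t
}.

Definition pullback_choice (C : category) : Type :=
  forall (A B Z : C) (f : A ~> Z) (g : B ~> Z), pullback f g.

Lemma cob_sec_comm (C : category) (Y' Y : C) (y : Y' ~> Y) (p : PtOver Y) :
  po_epi p ∘ (po_sec p ∘ y) = y ∘ idm Y'.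
Proof. rewrite compA, po_split, comp1m, compm1; reflexivity. Qed.

Definition cob_ob (C : category) (pb : pullback_choice C) (Y' Y : C)
    (y : Y' ~> Y) (p : PtOver Y) : PtOver Y' :=
  @PointOver C Y' (pb_ob (pb _ _ _ (po_epi p) y)) (pb2 (pb _ _ _ (po_epi p) y))
    (pb_lift (pb _ _ _ (po_epi p) y) (cob_sec_comm y p)) (pb_lift2 _ _).

Lemma cob_map_comm (C : category) (pb : pullback_choice C) (Y' Y : C)
    (y : Y' ~> Y) (p q : PtOver Y) (m : p ~> q) :
  po_epi q ∘ (pom m ∘ pb1 (pb _ _ _ (po_epi p) y)) = y ∘ pb2 (pb _ _ _ (po_epi p) y).
Proof. rewrite compA, pom_epi, pb_comm; reflexivity. Qed.

Definition cob_map (C : category) (pb : pullback_choice C) (Y' Y : C)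
    (y : Y' ~> Y) (p q : PtOver Y) (m : p ~> q) : cob_ob pb y p ~> cob_ob pb y q.
Proof.
refine (@PointOverMap C Y' (cob_ob pb y p) (cob_ob pb y q)
          (pb_lift (pb _ _ _ (po_epi q) y) (cob_map_comm pb y m)) _ _).
- apply pb_lift2.
- apply (@pb_monic C _ _ _ _ _ (pb _ _ _ (po_epi q) y)); simpl.
  + rewrite compA, !pb_lift1, <- compA, pb_lift1, compA, pom_sec; reflexivity.
  + rewrite compA, !pb_lift2; reflexivity.
Defined.

(** The change of base functor [y^* : Pt_Y C -> Pt_Y' C]. *)
Definition change_of_base (C : category) (pb : pullback_choice C) (Y' Y : C)
    (y : Y' ~> Y) : functor (PtOver Y) (PtOver Y').
Proof.
refine (@Functor (PtOver Y) (PtOver Y') (cob_ob pb y) (@cob_map C pb Y' Y y) _ _).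
- intros p; apply point_over_map_eq; simpl.
  apply (@pb_monic C _ _ _ _ _ (pb _ _ _ (po_epi p) y)).
  + rewrite pb_lift1, compm1; apply comp1m.
  + rewrite pb_lift2, compm1; reflexivity.
- intros p q r n m; apply point_over_map_eq; simpl.
  apply (@pb_monic C _ _ _ _ _ (pb _ _ _ (po_epi r) y)).
  + rewrite compA, !pb_lift1, <- !compA, pb_lift1; reflexivity.
  + rewrite compA, !pb_lift2; reflexivity.
Defined.

(** Change of base functors depend on a choice of pullbacks, only up to
    natural isomorphism. *)
Definition protomodular (C : category) : Prop :=
  finitely_complete C /\
  forall (pb : pullback_choice C) (Y' Y : C) (y : Y' ~> Y),
    conservative (change_of_base pb y).

(** * Action distinctive categories and eccentric points *)

Definition cartesian_equivalence (C : category) (p : Pt C)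
    (R : relation p) : Prop :=
  is_equivalence R /\ cartesian (d0 R) /\ cartesian (d1 R).

Definition is_distinctive (C : category) (p : Pt C) (D : relation p) : Prop :=
  cartesian_equivalence D /\
  forall R : relation p, cartesian_equivalence R -> rel_le R D.

Definition action_distinctive (C : category) : Prop :=
  maltsev C /\
  forall p : Pt C, exists D : relation p, is_distinctive D.

Definition eccentric (C : category) (p : Pt C) : Prop :=
  exists D : relation p, is_distinctive D /\ rel_eq D (discrete_rel p).

Definition enough_eccentric (C : category) : Prop :=
  forall p : Pt C, exists (q : Pt C) (m : p ~> q), cartesian m /\ eccentric q.

(** * Action accessible categories *)

Definition faithful (C : category) (p : Pt C) : Prop :=
  forall (p' : Pt C) (m0 m1 : p' ~> p), cartesian m0 -> cartesian m1 ->
  forall (K' K : C) (k' : K' ~> pt_dom p') (k : K ~> pt_dom p),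
    is_kernel k' (pt_epi p') -> is_kernel k (pt_epi p) ->
    forall i0 i1 : K' ~> K,
      k ∘ i0 = pm_dom m0 ∘ k' -> k ∘ i1 = pm_dom m1 ∘ k' ->
      i0 = i1 -> m0 = m1.

Definition action_accessible (C : category) : Prop :=
  pointed C /\ maltsev C /\
  forall p : Pt C, exists (q : Pt C) (m : p ~> q), cartesian m /\ faithful q.

(** * Normalizers *)

(** The internal functor [∇_U -> R] is [u] on objects and [m] on arrows; the
    two pullbacks say that it is a discrete fibration. *)
Definition normal_to (C : category) (U X : C) (u : U ~> X)
    (R : relation X) : Prop :=
  is_mono u /\
  exists (W : C) (p0 p1 : W ~> U) (HW : is_product p0 p1) (m : W ~> R),
    @is_inverse_image C U X u R (indiscrete_rel HW) m /\
    is_pullback m p0 (d0 R) u /\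
    is_pullback m p1 (d1 R) u.

Definition is_normalizer (C : category) (U T : C) (v : U ~> T)
    (X : C) (u : U ~> X) (R : relation X) (w : X ~> T) : Prop :=
  is_equivalence R /\ normal_to u R /\ v = w ∘ u /\
  forall (X' : C) (S : relation X') (u' : U ~> X') (h : X' ~> T),
    is_equivalence S -> normal_to u' S -> v = h ∘ u' ->
    exists! h' : X' ~> X, w ∘ h' = h /\ h' ∘ u' = u /\ rel_map S R h'.

Definition has_normalizers (C : category) : Prop :=
  forall (U T : C) (v : U ~> T), is_mono v ->
    exists (X : C) (u : U ~> X) (R : relation X) (w : X ~> T),
      is_normalizer v u R w.

(* Main.v *)
From Corelib Require Import ssreflect ssrfun.
From Stdlib Require Import IndefiniteDescription.
Require Import Defs.

Set Implicit Arguments.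
Unset Strict Implicit.
Unset Printing Implicit Defensive.

(** Both parts divide a point [p] by a relation in [Pt C] whose legs are
    cartesian.  In an exact Mal'tsev category such a reflexive relation is an
    effective equivalence relation both on total objects and on bases, its legs
    being cartesian makes the one a discrete fibration over the other, and the
    Barr-Kock theorem says that the square of quotient maps is a pullback.
    Thus [p] has a cartesian map to the quotient point
    ([cartesian_quotient]), and it remains to choose the relation.

    For part (1), divide by the distinctive relation [D] of [p].  The inverse
    image on [p] of the distinctive relation of the quotient is again a
    cartesian equivalence relation ([cartesian_inverse_image]), hence is
    contained in [D], hence is sent into the diagonal by the quotient map; as it
    covers the distinctive relation of the quotient, the latter is discrete.

    For part (2), write [X] for the total object of [p] and [K] for its kernel.
    The normalizer of the diagonal copy of [K] in [X * X] is a relation on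
    [X]; for groups it relates the elements that induce the same conjugation on
    [K] ([diagonal_normalizer]).  Restricted to the base along the section, it
    becomes the base of a cartesian relation on [p], through which any two
    cartesian maps into [p] that agree on kernels factor
    ([same_action_relation]).  The quotient by this relation is faithful,
    because cartesian maps into it lift to [p] after a cover.  Protomodularity
    enters in three ways: a map of points that is bijective on kernels is
    cartesian, a section and the kernel are jointly strongly epic, and every
    relation is difunctional, so that the category is Mal'tsev.

    Limits are handled through generalized elements: an object is described by
    the maps into it from an arbitrary [T]. *)

(** * Generalized elements, pullbacks and relations *)

Lemma comp_absorb (C : category) (W X Y Z : C) (g : Y ~> Z) (f : X ~> Y)
    (h : X ~> Z) (w : W ~> X) : g ∘ f = h -> g ∘ (f ∘ w) = h ∘ w.
Proof. by move=> <-; rewrite compA. Qed.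

Lemma comp_swap (C : category) (W X Y Y' Z : C) (g : Y ~> Z) (f : X ~> Y)
    (g' : Y' ~> Z) (f' : X ~> Y') (w : W ~> X) :
  g ∘ f = g' ∘ f' -> g ∘ (f ∘ w) = g' ∘ (f' ∘ w).
Proof. by move=> e; rewrite !compA e. Qed.

Definition is_epi (C : category) (X Y : C) (f : X ~> Y) : Prop :=
  forall (T : C) (a b : Y ~> T), a ∘ f = b ∘ f -> a = b.

Lemma coequalizer_epi (C : category) (R X Q : C) (a b : R ~> X) (q : X ~> Q) :
  is_coequalizer a b q -> is_epi q.
Proof.
move=> [e U] T c d H.
have [r [_ Hr]] := U T (d ∘ q) ltac:(by rewrite -!compA e).
by rewrite -(Hr c H) -(Hr d erefl).
Qed.

Lemma regular_epi_epi (C : category) (X Q : C) (q : X ~> Q) :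
  regular_epi q -> is_epi q.
Proof. by move=> [R [a [b H]]]; apply: coequalizer_epi H. Qed.

Lemma epi_comp (C : category) (X Y Z : C) (f : X ~> Y) (g : Y ~> Z) :
  is_epi f -> is_epi g -> is_epi (g ∘ f).
Proof. by move=> Hf Hg T a b; rewrite !compA => /Hf/Hg. Qed.

Lemma is_pullbackI (C : category) (P A B Z : C)
    (a : P ~> A) (b : P ~> B) (f : A ~> Z) (g : B ~> Z) :
  f ∘ a = g ∘ b ->
  (forall (T : C) (u : T ~> A) (v : T ~> B), f ∘ u = g ∘ v ->
     exists t, a ∘ t = u /\ b ∘ t = v) ->
  (forall (T : C) (s t : T ~> P), a ∘ s = a ∘ t -> b ∘ s = b ∘ t -> s = t) ->
  is_pullback a b f g.
Proof.
move=> e E U; split=> // T u v /E [t [ta tb]].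
by exists t; split=> // s [sa sb]; apply: U; rewrite ?ta ?tb.
Qed.

Lemma pullback_lift (C : category) (P A B Z : C)
    (a : P ~> A) (b : P ~> B) (f : A ~> Z) (g : B ~> Z) :
  is_pullback a b f g -> forall (T : C) (u : T ~> A) (v : T ~> B),
  f ∘ u = g ∘ v -> exists t, a ∘ t = u /\ b ∘ t = v.
Proof. by move=> [_ U] T u v /U [t [H _]]; exists t. Qed.

Lemma pullback_monic (C : category) (P A B Z : C)
    (a : P ~> A) (b : P ~> B) (f : A ~> Z) (g : B ~> Z) :
  is_pullback a b f g -> forall (T : C) (s t : T ~> P),
  a ∘ s = a ∘ t -> b ∘ s = b ∘ t -> s = t.
Proof.
move=> [e U] T s t Ha Hb.
have [r [_ Hr]] := U T (a ∘ t) (b ∘ t) (comp_swap t e).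
by rewrite -(Hr s (conj Ha Hb)) -(Hr t (conj erefl erefl)).
Qed.

Lemma pullback_sym (C : category) (P A B Z : C)
    (a : P ~> A) (b : P ~> B) (f : A ~> Z) (g : B ~> Z) :
  is_pullback a b f g -> is_pullback b a g f.
Proof.
move=> H; apply: is_pullbackI.
- by case: H.
- move=> T u v e; have [t [ta tb]] := pullback_lift H (esym e).
  by exists t.
- by move=> T s t Hb Ha; apply: (pullback_monic H).
Qed.

(** A change of base functor is only available once pullbacks are chosen,
    whereas finite completeness merely asserts that they exist. *)
Lemma pullback_choice_exists (C : category) :
  finitely_complete C -> inhabited (pullback_choice C).
Proof.
move=> [_ H]; constructor=> A B Z f g.
have [P HP] := constructive_indefinite_description _ (H A B Z f g).
have [a Ha] := constructive_indefinite_description _ HP.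
have [b Hb] := constructive_indefinite_description _ Ha.
pose l T u v e :=
  constructive_indefinite_description _ (@pullback_lift _ _ _ _ _ _ _ _ _ Hb T u v e).
refine (@Pullback C A B Z f g P a b (proj1 Hb)
          (fun T u v e => proj1_sig (l T u v e)) _ _ (pullback_monic Hb)).
- by move=> T u v e; case: (proj2_sig (l T u v e)).
- by move=> T u v e; case: (proj2_sig (l T u v e)).
Qed.

Lemma product_exists (C : category) (A B : C) : finitely_complete C ->
  exists (W : C) (p0 : W ~> A) (p1 : W ~> B), is_product p0 p1.
Proof.
move=> [[Z HZ] H].
have [a _] := HZ A; have [b _] := HZ B.
have [P [p0 [p1 HP]]] := H _ _ _ a b.
exists P, p0, p1 => T u v; case: HP => _; apply.
by have [t [_ Ht]] := HZ T; rewrite -(Ht (a ∘ u) I) -(Ht (b ∘ v) I).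
Qed.

Lemma product_lift (C : category) (A B W : C) (p0 : W ~> A) (p1 : W ~> B) :
  is_product p0 p1 -> forall (T : C) (a : T ~> A) (b : T ~> B),
  exists t, p0 ∘ t = a /\ p1 ∘ t = b.
Proof. by move=> H T a b; have [t [Ht _]] := H T a b; exists t. Qed.

Lemma product_monic (C : category) (A B W : C) (p0 : W ~> A) (p1 : W ~> B) :
  is_product p0 p1 -> forall (T : C) (s t : T ~> W),
  p0 ∘ s = p0 ∘ t -> p1 ∘ s = p1 ∘ t -> s = t.
Proof.
move=> H T s t H0 H1; have [r [_ Hr]] := H T (p0 ∘ t) (p1 ∘ t).
by rewrite -(Hr s (conj H0 H1)) -(Hr t (conj erefl erefl)).
Qed.

Definition related (C : category) (X : C) (R : relation X) (T : C)
    (x y : T ~> X) : Prop :=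
  exists r : T ~> R, d0 R ∘ r = x /\ d1 R ∘ r = y.

Lemma related_comp (C : category) (X : C) (R : relation X) (T T' : C)
    (x y : T ~> X) (t : T' ~> T) :
  related R x y -> related R (x ∘ t) (y ∘ t).
Proof. by move=> [r [<- <-]]; exists (r ∘ t); rewrite !compA. Qed.

Lemma related_legs (C : category) (X : C) (R : relation X) (T : C)
    (r : T ~> R) : related R (d0 R ∘ r) (d1 R ∘ r).
Proof. by exists r. Qed.

Lemma reflexive_related (C : category) (X : C) (R : relation X) :
  rel_reflexive R -> forall (T : C) (x : T ~> X), related R x x.
Proof.
by move=> [r [r0 r1]] T x; exists (r ∘ x); rewrite !compA r0 r1 comp1m.
Qed.

Lemma equivalence_related (C : category) (X : C) (R : relation X) :
  (forall (T : C) (x : T ~> X), related R x x) ->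
  (forall (T : C) (x y : T ~> X), related R x y -> related R y x) ->
  (forall (T : C) (x y z : T ~> X),
     related R x y -> related R y z -> related R x z) ->
  is_equivalence R.
Proof.
move=> Hr Hs Ht; split; last split.
- exact: Hr.
- have [r [r0 r1]] := Hs _ _ _ (related_legs (idm R)).
  by exists r; rewrite r0 r1 !compm1.
- move=> T a b e; apply: (Ht _ _ (d1 R ∘ a)); first exact: related_legs.
  by rewrite e; exact: related_legs.
Qed.

Lemma symmetric_related (C : category) (X : C) (R : relation X) :
  is_equivalence R ->
  forall (T : C) (x y : T ~> X), related R x y -> related R y x.
Proof.
move=> [_ [[s [s0 s1]] _]] T x y [r [<- <-]].
by exists (s ∘ r); rewrite !compA s0 s1.
Qed.

Lemma transitive_related (C : category) (X : C) (R : relation X) :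
  is_equivalence R -> forall (T : C) (x y z : T ~> X),
  related R x y -> related R y z -> related R x z.
Proof.
move=> [_ [_ t]] T x y z [a [a0 a1]] [b [b0 b1]].
have [c [c0 c1]] := t T a b ltac:(by rewrite a1 b0).
by exists c; rewrite c0 c1.
Qed.

Lemma kernel_pair_related (C : category) (X Y : C) (R : relation X)
    (f : X ~> Y) : is_kernel_pair (d0 R) (d1 R) f ->
  forall (T : C) (x y : T ~> X), f ∘ x = f ∘ y <-> related R x y.
Proof.
move=> H T x y; split; first exact: pullback_lift H T x y.
by move=> [r [<- <-]]; case: H => e _; exact: comp_swap.
Qed.

Lemma kernel_pair_exists (C : category) (X Y : C) (f : X ~> Y) :
  finitely_complete C ->
  exists R : relation X, is_kernel_pair (d0 R) (d1 R) f.
Proof.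
move=> [_ H]; have [P [a [b HP]]] := H _ _ _ f f.
by exists (@Relation C X P a b (pullback_monic HP)).
Qed.

(** The source of every subobject that is cut out by a condition on elements:
    equalizers when [R] is discrete, intersections of relations when [a] and
    [b] are the legs of another relation. *)
Lemma comprehension (C : category) (X : C) (R : relation X) (W : C)
    (a b : W ~> X) : finitely_complete C ->
  exists (E : C) (e : E ~> W), is_mono e /\ related R (a ∘ e) (b ∘ e) /\
    forall (T : C) (t : T ~> W), related R (a ∘ t) (b ∘ t) ->
      exists t' : T ~> E, e ∘ t' = t.
Proof.
move=> fc; have [XX [p0 [p1 HX]]] := @product_exists C X X fc.
have [r [r0 r1]] := product_lift HX (d0 R) (d1 R).
have [c [c0 c1]] := product_lift HX a b.
have [E [i [e HE]]] := proj2 fc _ _ _ r c.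
have [ec _] := HE.
have E0 : d0 R ∘ i = a ∘ e by rewrite -r0 -c0 -!compA ec.
have E1 : d1 R ∘ i = b ∘ e by rewrite -r1 -c1 -!compA ec.
exists E, e; split; last split.
- move=> T s t H; apply: (pullback_monic HE) => //; apply: (@rel_monic _ _ R).
  + by rewrite !(comp_swap _ E0) H.
  + by rewrite !(comp_swap _ E1) H.
- by exists i.
- move=> T t [x [x0 x1]].
  have [|t' [_ Ht]] := @pullback_lift _ _ _ _ _ _ _ _ _ HE _ x t.
    by apply: (product_monic HX); rewrite !compA ?r0 ?r1 ?c0 ?c1.
  by exists t'.
Qed.

(** The inverse image of [R] along [f], built from two pullbacks, so that in
    a category of points its legs are visibly composites of base changes of
    [f] and of the legs of [R]. *)
Lemma inverse_image (C : category) (X Z P F : C) (R : relation X) (f : Z ~> X)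
    (a : P ~> Z) (b : P ~> R) (c : F ~> P) (e : F ~> Z) :
  is_pullback a b f (d0 R) -> is_pullback c e (d1 R ∘ b) f ->
  exists mon, let S := @Relation C Z F (a ∘ c) e mon in
  forall (T : C) (x y : T ~> Z), related S x y <-> related R (f ∘ x) (f ∘ y).
Proof.
move=> HP HF.
have [eP _] := HP; have [eF _] := HF.
unshelve eexists.
- move=> T s t H0 H1; apply: (pullback_monic HF) => //.
  apply: (pullback_monic HP); first by rewrite !compA.
  apply: (@rel_monic _ _ R).
  + by rewrite -!(comp_swap _ eP) [a ∘ (c ∘ s)]compA H0 -[a ∘ c ∘ t]compA.
  + by rewrite !(compA (d1 R)) !(comp_swap _ eF) H1.
- move=> S T x y; split.
  + move=> [r [<- <-]]; exists (b ∘ (c ∘ r)); rewrite /S /=; split.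
    * by rewrite -(comp_swap _ eP) !compA.
    * by rewrite -(comp_swap _ eF) !compA.
  + move=> [r [r0 r1]].
    have [u [ua ub]] := pullback_lift HP (esym r0).
    have [|v [vc ve]] := @pullback_lift _ _ _ _ _ _ _ _ _ HF _ u y.
      by rewrite -compA ub r1.
    by exists v; rewrite /S /= -compA vc.
Qed.

Lemma inverse_image_exists (C : category) (X Z : C) (R : relation X)
    (f : Z ~> X) : finitely_complete C ->
  exists S : relation Z, forall (T : C) (x y : T ~> Z),
    related S x y <-> related R (f ∘ x) (f ∘ y).
Proof.
move=> [_ H]; have [P [a [b HP]]] := H _ _ _ f (d0 R).
have [F [c [e HF]]] := H _ _ _ (d1 R ∘ b) f.
by have [mon HS] := inverse_image HP HF; eexists; exact: HS.
Qed.

Lemma relation_meet (C : category) (X : C) (R S : relation X) :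
  finitely_complete C ->
  exists M : relation X, forall (T : C) (x y : T ~> X),
    related M x y <-> related R x y /\ related S x y.
Proof.
move=> fc.
have [E [e [me [He E_ex]]]] := comprehension S (d0 R) (d1 R) fc.
unshelve eexists.
  refine (@Relation C X E (d0 R ∘ e) (d1 R ∘ e) _) => T s t H0 H1.
  by apply: me; apply: (@rel_monic _ _ R); rewrite !compA.
move=> T x y; split.
- move=> [r [<- <-]] /=; split; last exact: related_comp.
  by rewrite -!compA; exact: related_legs.
- move=> [[r [<- <-]] /E_ex [t <-]].
  by exists t; rewrite /= !compA.
Qed.

(** * Pullbacks and cartesian maps in the category of points *)

Lemma Pt_pullback (C : category) (p q r : Pt C) (m : p ~> r) (n : q ~> r) :
  finitely_complete C ->
  exists (P : Pt C) (a : P ~> p) (b : P ~> q), is_pullback a b m n /\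
    is_pullback (pm_dom a) (pm_dom b) (pm_dom m) (pm_dom n) /\
    is_pullback (pm_cod a) (pm_cod b) (pm_cod m) (pm_cod n).
Proof.
move=> [_ H].
have [X [x0 [x1 HX]]] := H _ _ _ (pm_dom m) (pm_dom n).
have [Y [y0 [y1 HY]]] := H _ _ _ (pm_cod m) (pm_cod n).
have [eX _] := HX; have [eY _] := HY.
have [|f [f0 f1]] := @pullback_lift _ _ _ _ _ _ _ _ _ HY X
    (pt_epi p ∘ x0) (pt_epi q ∘ x1).
  by rewrite !compA -!pm_epi -!compA eX.
have [|s [s0 s1]] := @pullback_lift _ _ _ _ _ _ _ _ _ HX Y
    (pt_sec p ∘ y0) (pt_sec q ∘ y1).
  by rewrite !compA !pm_sec -!compA eY.
have fs : f ∘ s = idm Y.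
  apply: (pullback_monic HY).
    by rewrite compA f0 -compA s0 compA pt_split comp1m compm1.
  by rewrite compA f1 -compA s1 compA pt_split comp1m compm1.
pose P : Pt C := Point fs.
pose a : P ~> p := @PointMap C P p x0 y0 (esym f0) s0.
pose b : P ~> q := @PointMap C P q x1 y1 (esym f1) s1.
exists P, a, b; split; last by [].
apply: is_pullbackI; first by apply: point_map_eq.
- move=> T u v e.
  have [t [t0 t1]] := pullback_lift HX (f_equal (@pm_dom _ _ _) e).
  have [w [w0 w1]] := pullback_lift HY (f_equal (@pm_cod _ _ _) e).
  have tf : f ∘ t = w ∘ pt_epi T.
    apply: (pullback_monic HY).
      by rewrite !compA f0 w0 -compA t0 pm_epi.
    by rewrite !compA f1 w1 -compA t1 pm_epi.
  have ts : t ∘ pt_sec T = s ∘ w.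
    apply: (pullback_monic HX).
      by rewrite !compA s0 t0 -compA w0 pm_sec.
    by rewrite !compA s1 t1 -compA w1 pm_sec.
  exists (@PointMap C T P t w tf ts).
  by split; apply: point_map_eq.
- move=> T s' t' Ha Hb; apply: point_map_eq.
  + exact: (pullback_monic HX (f_equal (@pm_dom _ _ _) Ha)
                             (f_equal (@pm_dom _ _ _) Hb)).
  + exact: (pullback_monic HY (f_equal (@pm_cod _ _ _) Ha)
                             (f_equal (@pm_cod _ _ _) Hb)).
Qed.

Lemma cartesian_comp (C : category) (p q r : Pt C) (m : p ~> q) (n : q ~> r) :
  cartesian m -> cartesian n -> cartesian (n ∘ m).
Proof.
move=> Hm Hn; apply: is_pullbackI.
- exact: (pm_epi (n ∘ m : point_map p r)).
- move=> T u v /= e.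
  have [t [t0 t1]] := @pullback_lift _ _ _ _ _ _ _ _ _ Hn T u (pm_cod m ∘ v)
    ltac:(by rewrite e compA).
  have [w [w0 w1]] := pullback_lift Hm t1.
  by exists w; split; rewrite // -compA w0.
- move=> T s t /= Hs Ht; apply: (pullback_monic Hm) => //.
  apply: (pullback_monic Hn); first by rewrite !compA.
  by rewrite !compA pm_epi -!compA Ht.
Qed.

(** The hypotheses describe a pullback of [n] along [m] in [Pt C], as seen on
    total objects and on bases. *)
Lemma cartesian_base_change (C : category) (P p q r : Pt C)
    (a : P ~> p) (b : P ~> q) (m : p ~> r) (n : q ~> r) :
  is_pullback (pm_dom a) (pm_dom b) (pm_dom m) (pm_dom n) ->
  is_pullback (pm_cod a) (pm_cod b) (pm_cod m) (pm_cod n) ->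
  cartesian n -> cartesian a.
Proof.
move=> HX HY Hn; have [eX _] := HX; have [eY _] := HY.
apply: is_pullbackI; first exact: pm_epi.
- move=> T u v e.
  have [|z [z0 z1]] := @pullback_lift _ _ _ _ _ _ _ _ _ Hn T
      (pm_dom m ∘ u) (pm_cod b ∘ v).
    by rewrite compA pm_epi -compA e (comp_swap _ eY).
  have [t [t0 t1]] := pullback_lift HX (esym z0).
  exists t; split=> //; apply: (pullback_monic HY).
  + by rewrite compA -pm_epi -compA t0.
  + by rewrite compA -pm_epi -compA t1.
- move=> T s t Hs Ht; apply: (pullback_monic HX) => //.
  apply: (pullback_monic Hn).
  + by rewrite -!(comp_swap _ eX) Hs.
  + by rewrite !compA pm_epi -!compA Ht.
Qed.

(** A relation in [Pt C] is monic at the level of bases because an element of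
    the base of a point is a map from an identity point. *)
Lemma base_monic (C : category) (p : Pt C) (D : relation p) (T : C)
    (a b : T ~> pt_cod (rel_ob D)) :
  pm_cod (d0 D) ∘ a = pm_cod (d0 D) ∘ b ->
  pm_cod (d1 D) ∘ a = pm_cod (d1 D) ∘ b -> a = b.
Proof.
pose i : Pt C := Point (comp1m (idm T)).
have lift c : exists m : i ~> D,
    pm_cod m = c /\ pm_dom m = pt_sec (rel_ob D) ∘ c.
  unshelve eexists (@PointMap C i (rel_ob D) (pt_sec (rel_ob D) ∘ c) c _ _) => //=.
    by rewrite compA pt_split comp1m compm1.
  by rewrite compm1.
have [m [mc md]] := lift a; have [n [nc nd]] := lift b.
move=> H0 H1; suff e : m = n by rewrite -mc -nc e.
apply: (@rel_monic _ _ D); apply: point_map_eq => /=.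
- by rewrite md nd !compA !pm_sec -!compA H0.
- by rewrite mc nc.
- by rewrite md nd !compA !pm_sec -!compA H1.
- by rewrite mc nc.
Qed.

(** An element of a cartesian relation is determined by its first leg and its
    image in the base, where [base_monic] applies. *)
Lemma total_monic (C : category) (p : Pt C) (D : relation p) (T : C)
    (a b : T ~> pt_dom (rel_ob D)) : cartesian (d0 D) ->
  pm_dom (d0 D) ∘ a = pm_dom (d0 D) ∘ b ->
  pm_dom (d1 D) ∘ a = pm_dom (d1 D) ∘ b -> a = b.
Proof.
move=> HD H0 H1; apply: (pullback_monic HD) => //; apply: base_monic.
- by rewrite !compA -!pm_epi -!compA H0.
- by rewrite !compA -!pm_epi -!compA H1.
Qed.

(** * Quotients by cartesian equivalence relations *)

(** Exactness gives some map with kernel pair [R]; the coequalizer still has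
    [R] as its kernel pair because that map factors through it. *)
Lemma quotient_exists (C : category) (X : C) (R : relation X) :
  barr_exact C -> is_equivalence R ->
  exists (Q : C) (q : X ~> Q),
    is_coequalizer (d0 R) (d1 R) q /\ is_kernel_pair (d0 R) (d1 R) q.
Proof.
move=> [[_ [Hq _]] Hex] /Hex [Y [f Hf]].
have [Q [q Hc]] := Hq _ _ _ _ _ _ Hf.
have [e U] := Hc; have [ef _] := Hf.
have [r [rq _]] := U _ f ef.
exists Q, q; split=> //; apply: is_pullbackI => //.
- move=> T x y e'; apply: (pullback_lift Hf).
  by rewrite -rq -!compA e'.
- exact: pullback_monic Hf.
Qed.

(** The Barr-Kock theorem.  Injectivity of the comparison into the pullback
    comes from uniqueness of lifts along the discrete fibration, since the
    trivial lift is one of them.  For surjectivity, an element [(x', y)] of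
    the pullback is first lifted to some [x] over [x'], after a cover, and
    then [x] is moved inside its class until it lies over [y]; the result
    descends along the cover by injectivity. *)
Lemma barr_kock (C : category) (R X X' S Y Y' : C)
    (r0 r1 : R ~> X) (s0 s1 : S ~> Y) (phi : R ~> S) (f : X ~> Y)
    (g : X' ~> Y') (qX : X ~> X') (qY : Y ~> Y') :
  regular_category C ->
  is_kernel_pair r0 r1 qX -> is_kernel_pair s0 s1 qY ->
  is_pullback r0 phi f s0 -> s1 ∘ phi = f ∘ r1 ->
  regular_epi qX -> g ∘ qX = qY ∘ f ->
  is_pullback qX f g qY.
Proof.
move=> [[_ Hpb] [_ stable]] HX HY Hphi e1 qXreg eg.
have [e0 _] := Hphi; have [eX _] := HX.
have inj T (a b : T ~> X) : qX ∘ a = qX ∘ b -> f ∘ a = f ∘ b -> a = b.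
  move=> Hq Hf.
  have [r [ra rb]] := pullback_lift HX Hq.
  have [i [i0 i1]] := pullback_lift HX (erefl (qX ∘ a)).
  (* both [r] and the trivial pair [i] start at [a] and lie over [(f a, f a)] *)
  suff -> : b = r1 ∘ i by rewrite i1.
  rewrite -rb; congr (_ ∘ _); apply: (pullback_monic Hphi).
    by rewrite ra i0.
  apply: (pullback_monic HY).
    by rewrite -!(comp_swap _ e0) ra i0.
  by rewrite !(comp_swap _ e1) rb i1.
apply: is_pullbackI => // T x' y e.
have [P [h [c HP]]] := Hpb _ _ _ qX x'.
have [ec _] := HP.
have [A [k0 [k1 Hc]]] := stable _ _ _ _ _ _ _ _ HP qXreg.
have [s [sh sy]] : exists s, s0 ∘ s = f ∘ h /\ s1 ∘ s = y ∘ c.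
  apply: (pullback_lift HY).
  by rewrite compA -eg -compA ec compA e compA.
have [r [rh rs]] := pullback_lift Hphi (esym sh).
have [l [lx ly]] : exists l, qX ∘ l = x' ∘ c /\ f ∘ l = y ∘ c.
  exists (r1 ∘ r); split; first by rewrite -(comp_swap _ eX) rh ec.
  by rewrite -(comp_swap _ e1) rs sy.
have [ek U] := Hc.
have [|t [tc _]] := U _ l.
  apply: inj; first by rewrite !compA lx -!compA ek.
  by rewrite !compA ly -!compA ek.
have epi := coequalizer_epi Hc.
by exists t; split; apply: epi; rewrite -compA tc.
Qed.

(** In an exact Mal'tsev category, a point can be divided by a reflexive
    relation with cartesian legs: both levels are effective equivalence
    relations, and the quotient map is cartesian by the Barr-Kock theorem. *)
Lemma cartesian_quotient (C : category) (p : Pt C) (D : relation p) :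
  barr_exact C -> maltsev C ->
  rel_reflexive D -> cartesian (d0 D) ->
  exists (q : Pt C) (m : p ~> q),
    cartesian m /\ m ∘ d0 D = m ∘ d1 D /\
    regular_epi (pm_dom m) /\ regular_epi (pm_cod m) /\
    is_kernel_pair (pm_cod (d0 D)) (pm_cod (d1 D)) (pm_cod m).
Proof.
move=> Hex [_ Hm] [i [i0 i1]] HD.
pose RX := @Relation C (pt_dom p) _ _ _ (fun T a b => @total_monic C p D T a b HD).
pose RY := @Relation C (pt_cod p) _ _ _ (@base_monic C p D).
have EX : is_equivalence RX.
  apply: Hm; exists (pm_dom i).
  by split; [exact: (f_equal (@pm_dom _ _ _) i0)
            | exact: (f_equal (@pm_dom _ _ _) i1)].
have EY : is_equivalence RY.
  apply: Hm; exists (pm_cod i).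
  by split; [exact: (f_equal (@pm_cod _ _ _) i0)
            | exact: (f_equal (@pm_cod _ _ _) i1)].
have [X' [qX [cX kX]]] := quotient_exists Hex EX.
have [Y' [qY [cY kY]]] := quotient_exists Hex EY.
move: kX kY cX cY; rewrite /RX /RY /= => kX kY cX cY.
have [eX UX] := cX; have [eY UY] := cY.
have [g [Hg _]] : exists! g, g ∘ qX = qY ∘ pt_epi p.
  by apply: UX; rewrite -!compA !pm_epi !compA eY.
have [t [Ht _]] : exists! t, t ∘ qY = qX ∘ pt_sec p.
  by apply: UY; rewrite -!compA -!pm_sec !compA eX.
have gt : g ∘ t = idm Y'.
  apply: (coequalizer_epi cY).
  by rewrite -compA Ht compA Hg -compA pt_split compm1 comp1m.
pose q : Pt C := Point gt.
exists q, (@PointMap C p q qX qY Hg (esym Ht)).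
split; last split; last split; last split => //.
- apply: (barr_kock (proj1 Hex) kX kY HD) => //.
  + by rewrite pm_epi.
  + by exists (pt_dom (rel_ob D)), (pm_dom (d0 D)), (pm_dom (d1 D)).
- exact: point_map_eq.
- by exists (pt_dom (rel_ob D)), (pm_dom (d0 D)), (pm_dom (d1 D)).
- by exists (pt_cod (rel_ob D)), (pm_cod (d0 D)), (pm_cod (d1 D)).
Qed.

(** * Enough eccentric objects *)

(** The inverse image of a cartesian equivalence relation along a cartesian
    map [m] is again one; moreover it covers the original relation when [m]
    is a regular epimorphism at both levels. *)
Lemma cartesian_inverse_image (C : category) (p q : Pt C) (m : p ~> q)
    (E : relation q) :
  regular_category C -> cartesian m ->
  regular_epi (pm_dom m) -> regular_epi (pm_cod m) ->
  cartesian_equivalence E ->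
  exists (F : relation p) (e : F ~> E), cartesian_equivalence F /\
    d0 E ∘ e = m ∘ d0 F /\ d1 E ∘ e = m ∘ d1 F /\
    is_epi (pm_dom e) /\ is_epi (pm_cod e).
Proof.
move=> [fc [_ stable]] Hm mX mY [Eeq [E0 E1]].
have [P [a [b [HP [HPX HPY]]]]] := Pt_pullback m (d0 E) fc.
have [F [c [e [HF [HFX HFY]]]]] := Pt_pullback (d1 E ∘ b) m fc.
have [eP _] := HP; have [eF _] := HF.
have [mon HS] := inverse_image HP HF.
exists (@Relation (Pt C) p F (a ∘ c) e mon), (b ∘ c).
have Ha : cartesian a := cartesian_base_change HPX HPY E0.
have Hb : cartesian b :=
  cartesian_base_change (pullback_sym HPX) (pullback_sym HPY) Hm.
have Hc : cartesian c := cartesian_base_change HFX HFY Hm.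
have He : cartesian e.
  apply: (cartesian_base_change (pullback_sym HFX) (pullback_sym HFY)).
  exact: cartesian_comp.
split; last split; last split; last split.
- split; last by split=> //; exact: cartesian_comp.
  apply: equivalence_related => T.
  + by move=> x; apply/HS; apply: reflexive_related; case: Eeq.
  + by move=> x y /HS H; apply/HS; exact: symmetric_related.
  + move=> x y z /HS H /HS K; apply/HS.
    exact: (transitive_related Eeq H K).
- exact: (esym (comp_swap c eP)).
- by rewrite compA; exact: eF.
- apply: epi_comp; apply: regular_epi_epi.
  + exact: (stable _ _ _ _ _ _ _ _ (pullback_sym HFX) mX).
  + exact: (stable _ _ _ _ _ _ _ _ HPX mX).
- apply: epi_comp; apply: regular_epi_epi.
  + exact: (stable _ _ _ _ _ _ _ _ (pullback_sym HFY) mY).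
  + exact: (stable _ _ _ _ _ _ _ _ HPY mY).
Qed.

(** The quotient of a point by its distinctive relation is eccentric: the
    inverse image of the distinctive relation of the quotient is cartesian,
    so it lies in the relation divided out, and it covers what it comes
    from. *)
Lemma exact_enough_eccentric (C : category) :
  barr_exact C -> action_distinctive C -> enough_eccentric C.
Proof.
move=> Hex [Hm Hd] p.
have [D [[Deq [D0 _]] Dmax]] := Hd p.
have [q [m [mcart [mD [mX [mY _]]]]]] :=
  cartesian_quotient Hex Hm (proj1 Deq) D0.
exists q, m; split=> //.
have [E [HE Emax]] := Hd q; exists E; split; first by split.
have [F [e [HF [e0 [e1 [eX eY]]]]]] :=
  cartesian_inverse_image (proj1 Hex) mcart mX mY HE.
have [x [x0 x1]] := Dmax F HF.
have same : d0 E ∘ e = d1 E ∘ e.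
  by rewrite e0 e1 -x0 -x1 !compA mD.
split.
- exists (d0 E); split; first exact: comp1m.
  apply: etrans (comp1m _) _; apply: point_map_eq.
  + exact: (eX _ _ _ (f_equal (@pm_dom _ _ _) same)).
  + exact: (eY _ _ _ (f_equal (@pm_cod _ _ _) same)).
- by case: HE => [[[r [r0 r1]] _] _]; exists r.
Qed.

(** * Null maps, kernels and protomodularity *)

(** Quantifying over the zero object avoids choosing one; by [null_eq] parallel
    null maps are equal all the same. *)
Definition null (C : category) (X Y : C) (f : X ~> Y) : Prop :=
  exists (Z : C) (a : X ~> Z) (b : Z ~> Y), is_zero Z /\ f = b ∘ a.

Lemma null_eq (C : category) (X Y : C) (f g : X ~> Y) :
  null f -> null g -> f = g.
Proof.
move=> [Z [a [b [[HZ _] ->]]]] [Z' [a' [b' [[_ HZ'] ->]]]].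
have [z _] := HZ Z'; have [u [_ Hu]] := HZ X; have [v [_ Hv]] := HZ' Y.
by rewrite -(Hv b' I) (Hv (b ∘ z) I) -compA -(Hu a I) (Hu (z ∘ a') I).
Qed.

Lemma null_precomp (C : category) (W X Y : C) (f : X ~> Y) (w : W ~> X) :
  null f -> null (f ∘ w).
Proof.
by move=> [Z [a [b [HZ ->]]]]; exists Z, (a ∘ w), b; rewrite compA.
Qed.

Lemma null_postcomp (C : category) (X Y Z : C) (f : X ~> Y) (g : Y ~> Z) :
  null f -> null (g ∘ f).
Proof.
by move=> [O [a [b [HZ ->]]]]; exists O, a, (g ∘ b); rewrite compA.
Qed.

Lemma null_exists (C : category) (X Y : C) : pointed C ->
  exists f : X ~> Y, null f.
Proof.
move=> [Z HZ]; have [[a _] [b _]] := (proj1 HZ X, proj2 HZ Y).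
by exists (b ∘ a), Z, a, b.
Qed.

Lemma kernel_null (C : category) (K X Y : C) (k : K ~> X) (f : X ~> Y) :
  is_kernel k f -> null (f ∘ k).
Proof. by move=> [Z [a [b [HZ [e _]]]]]; exists Z, a, b. Qed.

Lemma kernel_lift (C : category) (K X Y : C) (k : K ~> X) (f : X ~> Y) :
  is_kernel k f -> forall (T : C) (x : T ~> X), null (f ∘ x) ->
  exists x', k ∘ x' = x.
Proof.
move=> [Z [a [b [HZ HP]]]] T x Hx; have [t _] := proj1 HZ T.
have [|x' [Hx' _]] := @pullback_lift _ _ _ _ _ _ _ _ _ HP T x t.
  by apply: null_eq => //; exists Z, t, b.
by exists x'.
Qed.

Lemma kernel_mono (C : category) (K X Y : C) (k : K ~> X) (f : X ~> Y) :
  is_kernel k f -> is_mono k.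
Proof.
move=> [Z [a [b [HZ HP]]]] T s t H; apply: (pullback_monic HP) => //.
by have [u [_ Hu]] := proj1 HZ T; rewrite -(Hu (a ∘ s) I) (Hu (a ∘ t) I).
Qed.

Lemma kernel_exists (C : category) (X Y : C) (f : X ~> Y) :
  finitely_complete C -> pointed C ->
  exists (K : C) (k : K ~> X), is_kernel k f.
Proof.
move=> [_ H] [Z HZ]; have [b _] := proj2 HZ Y.
have [K [k [a HK]]] := H _ _ _ f b.
by exists K, k, Z, a, b.
Qed.

(** In a pointed protomodular category a map of points over [Y] which is
    bijective on kernels is invertible: this is conservativity of the change
    of base along the null subobject of [Y]. *)
Lemma kernel_bijective_iso (C : category) (Y : C) (p q : PtOver Y)
    (m : p ~> q) : pointed C -> protomodular C ->
  (forall (T : C) (b : T ~> po_dom q), null (po_epi q ∘ b) ->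
     exists a, pom m ∘ a = b) ->
  (forall (T : C) (a a' : T ~> po_dom p),
     null (po_epi p ∘ a) -> null (po_epi p ∘ a') ->
     pom m ∘ a = pom m ∘ a' -> a = a') ->
  is_iso (pom m).
Proof.
move=> [Z HZ] [fc Hc] surj inj.
have [pb] := pullback_choice_exists fc.
have [y _] := proj2 HZ Y.
have nully T (t : T ~> Z) : null (y ∘ t) by exists Z, t, y.
suff : is_iso m.
  move=> [n [n0 n1]]; exists (pom n).
  by split; [exact: (f_equal (@pom _ _ _ _) n0)
            | exact: (f_equal (@pom _ _ _ _) n1)].
apply: (Hc pb Z Y y).
set F := fmap _ _.
pose P := pb _ _ _ (po_epi p) y; pose Q := pb _ _ _ (po_epi q) y.
have F1 : pb1 Q ∘ pom F = pom m ∘ pb1 P by exact: pb_lift1.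
have F2 : pb2 Q ∘ pom F = pb2 P by exact: pb_lift2.
have [a Ha] : exists a, pom m ∘ a = pb1 Q.
  by apply: surj; rewrite pb_comm.
have e : po_epi p ∘ a = y ∘ pb2 Q.
  by rewrite -(pom_epi m) -compA Ha pb_comm.
pose i := pb_lift P e.
have Fi : pom F ∘ i = idm _.
  apply: (pb_monic (p := Q)).
    by rewrite compA F1 -compA pb_lift1 Ha compm1.
  by rewrite compA F2 pb_lift2 compm1.
have iF : i ∘ pom F = idm _.
  apply: (pb_monic (p := P)); last by rewrite compA pb_lift2 F2 compm1.
  apply: inj.
    by rewrite [pb1 P ∘ _]compA pb_lift1 compA e -compA.
    by rewrite compm1 pb_comm.
  by rewrite [pb1 P ∘ _]compA pb_lift1 compA Ha F1 compm1.
have si : i ∘ po_sec (cob_ob pb y q) = po_sec (cob_ob pb y p).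
  by rewrite -(pom_sec F) compA iF comp1m.
exists (@PointOverMap C Z (cob_ob pb y q) (cob_ob pb y p) i (pb_lift2 _ _) si).
by split; apply: point_over_map_eq.
Qed.

(** A section and the kernel of a split epimorphism are jointly strongly
    epic: a subobject [E] of [X] that contains both is itself a point over
    [Y], with the same kernel as [X]. *)
Lemma section_kernel_generate (C : category) (X Y E : C) (f : X ~> Y)
    (s : Y ~> X) (e : E ~> X) : pointed C -> protomodular C ->
  f ∘ s = idm Y -> is_mono e ->
  (exists s', e ∘ s' = s) ->
  (forall (T : C) (x : T ~> X), null (f ∘ x) -> exists x', e ∘ x' = x) ->
  exists e', e ∘ e' = idm X.
Proof.
move=> pt pm fs me [s' es'] He.
have fs' : (f ∘ e) ∘ s' = idm Y by rewrite -compA es'.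
pose p : PtOver Y := PointOver fs'; pose q : PtOver Y := PointOver fs.
pose m : p ~> q := @PointOverMap C Y p q e erefl es'.
have [||e' [_ H]] := @kernel_bijective_iso C Y p q m pt pm.
  by move=> T b; exact: He.
  by move=> T a a' _ _; exact: me.
by exists e'.
Qed.

Lemma section_kernel_epic (C : category) (X Y A : C) (f : X ~> Y)
    (s : Y ~> X) (g h : X ~> A) : pointed C -> protomodular C ->
  f ∘ s = idm Y -> g ∘ s = h ∘ s ->
  (forall (T : C) (x : T ~> X), null (f ∘ x) -> g ∘ x = h ∘ x) ->
  g = h.
Proof.
move=> pt pm fs es ek.
(* The equalizer of [g] and [h]. *)
have [E [e [me [[r [r0 r1]] He]]]] :=
  comprehension (discrete_rel A) g h (proj1 pm).
have eq T (x : T ~> X) : g ∘ x = h ∘ x -> exists x', e ∘ x' = x.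
  by move=> H; apply: He; exists (g ∘ x); rewrite /= !comp1m.
have [||e' He'] := section_kernel_generate pt pm fs me.
- exact: eq.
- by move=> T x /ek/eq.
- move: r0 r1; rewrite /= !comp1m => -> ge.
  by rewrite -(compm1 g) -(compm1 h) -He' !compA ge.
Qed.

(** The comparison from [p] to the pullback of [q] is a map of points over the
    base of [p], and it is bijective on kernels since [q] and its pullback have
    the same kernel. *)
Lemma kernel_bijective_cartesian (C : category) (p q : Pt C) (m : p ~> q) :
  pointed C -> protomodular C ->
  (forall (T : C) (b : T ~> pt_dom q), null (pt_epi q ∘ b) ->
     exists a, null (pt_epi p ∘ a) /\ pm_dom m ∘ a = b) ->
  (forall (T : C) (a a' : T ~> pt_dom p),
     null (pt_epi p ∘ a) -> null (pt_epi p ∘ a') ->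
     pm_dom m ∘ a = pm_dom m ∘ a' -> a = a') ->
  cartesian m.
Proof.
move=> pt pm surj inj.
have [P [a [b HP]]] := proj2 (proj1 pm) _ _ _ (pt_epi q) (pm_cod m).
have [eP _] := HP.
have [|s [sa sb]] := @pullback_lift _ _ _ _ _ _ _ _ _ HP _
    (pt_sec q ∘ pm_cod m) (idm _).
  by rewrite compA pt_split comp1m compm1.
have [c [ca cb]] := pullback_lift HP (pm_epi m).
pose p' : PtOver (pt_cod p) := PointOver (pt_split p).
pose P' : PtOver (pt_cod p) := PointOver sb.
have cs : c ∘ pt_sec p = s.
  apply: (pullback_monic HP); first by rewrite compA ca sa pm_sec.
  by rewrite compA cb sb pt_split.
pose c' : p' ~> P' := @PointOverMap C (pt_cod p) p' P' c cb cs.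
have [|| i [i0 i1]] := @kernel_bijective_iso C _ p' P' c' pt pm.
- move=> T x /= Hx.
  have [|z [z0 z1]] := surj T (a ∘ x).
    by rewrite (comp_swap x eP); exact: null_postcomp.
  exists z; apply: (pullback_monic HP); first by rewrite compA ca.
  by apply: null_eq => //; rewrite compA cb.
- move=> T x x' /= Hx Hx' H; apply: inj => //.
  by rewrite -ca -!compA H.
- rewrite /= in i0 i1; apply: is_pullbackI; first exact: pm_epi.
  + move=> T u v e; have [t [t0 t1]] := pullback_lift HP e.
    by exists (i ∘ t); rewrite -ca -cb -!compA [c ∘ _]compA i1 comp1m.
  + move=> T x y H0 H1; rewrite -(comp1m x) -(comp1m y) -i0 -!compA.
    congr (_ ∘ _); apply: (pullback_monic HP).
      by rewrite !compA ca.
    by rewrite !compA cb.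
Qed.

(** In a pointed protomodular category every relation is difunctional.  The
    zigzags [x R y, z R y, z R w] form a point over the object of the spans
    [(x, y, z)], with section [w := y]; those with [x R w] contain this
    section and, as [x = z = 0] on the kernel, the kernel. *)
Lemma protomodular_difunctional (C : category) (X : C) (R : relation X)
    (T : C) (x y z w : T ~> X) : pointed C -> protomodular C ->
  related R x y -> related R z y -> related R z w -> related R x w.
Proof.
move=> pt pm; have [fc _] := pm; have [_ Hpb] := fc.
have [B [b1 [b2 HB]]] := Hpb _ _ _ (d1 R) (d1 R).
have [W [v [r HW]]] := Hpb _ _ _ (d0 R ∘ b2) (d0 R).
have [eB _] := HB; have [eW _] := HW.
have [|s [sv sr]] := @pullback_lift _ _ _ _ _ _ _ _ _ HW B (idm B) b2.
  by rewrite compm1.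
have [E [e [me [[re [re0 re1]] He]]]] :=
  comprehension R (d0 R ∘ b1 ∘ v) (d1 R ∘ r) fc.
have [||e' ee'] := section_kernel_generate pt pm sv me.
- apply: He; exists b1.
  by rewrite -[d1 R ∘ r ∘ s]compA sr -eB -[_ ∘ v ∘ s]compA sv compm1.
- move=> U t nt; apply: He.
  (* both [x] and [z] are null, hence equal, so [z R w] says [x R w] *)
  have -> : d0 R ∘ b1 ∘ v ∘ t = d0 R ∘ r ∘ t.
    rewrite -eW -!compA; apply: null_eq; do 2! [apply: null_postcomp].
      done.
    done.
  by exists (r ∘ t); rewrite !compA.
- move=> [rx [rx0 rx1]] [rz [rz0 rz1]] [rw [rw0 rw1]].
  have [|b [Hb1 Hb2]] := @pullback_lift _ _ _ _ _ _ _ _ _ HB T rx rz.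
    by rewrite rx1.
  have [|t [tv tr]] := @pullback_lift _ _ _ _ _ _ _ _ _ HW T b rw.
    by rewrite -compA Hb2 rz0.
  exists (re ∘ (e' ∘ t)); split.
  + by rewrite compA re0 -!compA (comp_absorb _ ee') comp1m tv Hb1.
  + by rewrite compA re1 -!compA (comp_absorb _ ee') comp1m tr.
Qed.

(** Symmetry is difunctionality along the zigzag [y R y, x R y, x R x], and
    transitivity along [x R y, y R y, y R z]. *)
Lemma protomodular_maltsev (C : category) :
  pointed C -> protomodular C -> maltsev C.
Proof.
move=> pt pm; split; first by case: pm.
move=> X R Hr; have rr := reflexive_related Hr.
have di := @protomodular_difunctional C X R _ _ _ _ _ pt pm.
apply: equivalence_related => // T.
- by move=> x y H; exact: (di _ y y x x).
- by move=> x y z H K; exact: (di _ x y y z).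
Qed.

(** * Normal monomorphisms and normalizers *)

(** Normality in terms of elements, here and in the next two lemmas: [U] lies in
    one class of [R] and is closed under [R].  One of the two pullbacks in the
    definition gives the other by symmetry of [R]. *)
Lemma normal_toI (C : category) (U X : C) (u : U ~> X) (R : relation X) :
  finitely_complete C -> is_mono u -> is_equivalence R ->
  (forall (T : C) (a b : T ~> U), related R (u ∘ a) (u ∘ b)) ->
  (forall (T : C) (a : T ~> U) (y : T ~> X), related R (u ∘ a) y ->
     exists b, u ∘ b = y) ->
  normal_to u R.
Proof.
move=> fc mu HR full closed; split=> //.
have [W [p0 [p1 HW]]] := @product_exists C U U fc.
have [m [m0 m1]] := full W p0 p1.
have lift T (a b : T ~> U) (r : T ~> R) : d0 R ∘ r = u ∘ a ->
    d1 R ∘ r = u ∘ b -> exists t, p0 ∘ t = a /\ p1 ∘ t = b /\ m ∘ t = r.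
  move=> ea eb; have [t [t0 t1]] := product_lift HW a b.
  exists t; split=> //; split=> //; apply: (@rel_monic _ _ R).
    by rewrite compA m0 -compA t0.
  by rewrite compA m1 -compA t1.
have mon T (s t : T ~> W) : m ∘ s = m ∘ t -> s = t.
  move=> e; apply: (product_monic HW); apply: mu; rewrite !compA.
    by rewrite -m0 -!compA e.
  by rewrite -m1 -!compA e.
exists W, p0, p1, HW, m; split; last split.
- split=> //; split=> // T a b r ea eb.
  have [t Ht] := lift T a b r ea eb.
  by exists t; split=> // t' [_ [_ e]]; apply: mon; case: Ht => _ [_ ->].
- apply: is_pullbackI => // T r a ea; last by move=> *; exact: mon.
  have [|b eb] := closed T a (d1 R ∘ r); first by exists r.
  by have [t [? [_ ?]]] := lift T a b r ea (esym eb); exists t.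
- apply: is_pullbackI => // T r b eb; last by move=> *; exact: mon.
  have [|a ea] := closed T b (d0 R ∘ r).
    by apply: symmetric_related => //; exists r.
  by have [t [_ [? ?]]] := lift T a b r (esym ea) eb; exists t.
Qed.

Lemma normal_full (C : category) (U X : C) (u : U ~> X) (R : relation X) :
  normal_to u R ->
  forall (T : C) (a b : T ~> U), related R (u ∘ a) (u ∘ b).
Proof.
move=> [_ [W [p0 [p1 [HW [m [[m0 [m1 _]] _]]]]]]] T a b.
have [t [<- <-]] := product_lift HW a b.
rewrite /= in m0 m1; rewrite !compA -m0 -m1; apply: related_comp; exact: related_legs.
Qed.

Lemma normal_closed (C : category) (U X : C) (u : U ~> X) (R : relation X) :
  normal_to u R -> forall (T : C) (a : T ~> U) (y : T ~> X),
  related R (u ∘ a) y -> exists b, u ∘ b = y.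
Proof.
move=> [_ [W [p0 [p1 [HW [m [[_ [m1 _]] [HP _]]]]]]]] T a y [r [r0 <-]].
have [t [<- _]] := pullback_lift HP r0; rewrite /= in m1.
by exists (p1 ∘ t); rewrite !compA m1.
Qed.

Lemma rel_map_related (C : category) (X Y : C) (R : relation X)
    (S : relation Y) (h : X ~> Y) : rel_map R S h ->
  forall (T : C) (x y : T ~> X), related R x y -> related S (h ∘ x) (h ∘ y).
Proof.
move=> [m [m0 m1]] T x y [r [<- <-]].
by exists (m ∘ r); rewrite !compA m0 m1.
Qed.

(** The two projections of the kernel pair of [w] are both solutions of one
    universal problem: the diagonal copy of [U] is normal to the relation
    induced by [R] on both coordinates, because [v] is monic. *)
Lemma normalizer_mono (C : category) (U T X : C) (v : U ~> T) (u : U ~> X)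
    (R : relation X) (w : X ~> T) :
  finitely_complete C -> is_mono v -> is_normalizer v u R w -> is_mono w.
Proof.
move=> fc mv [HR [Hu [vE univ]]].
have [Q HQ] := kernel_pair_exists w fc.
have [eQ _] := HQ.
have [u' [u0 u1]] : related Q u u by apply/(kernel_pair_related HQ).
have [S0 HS0] := inverse_image_exists R (d0 Q) fc.
have [S1 HS1] := inverse_image_exists R (d1 Q) fc.
have [S HS] := relation_meet S0 S1 fc.
have SE A (x y : A ~> Q) : related S x y <->
    related R (d0 Q ∘ x) (d0 Q ∘ y) /\ related R (d1 Q ∘ x) (d1 Q ∘ y).
  by split=> [/HS [/HS0 ? /HS1 ?] | [? ?]] //; apply/HS; split;
    [apply/HS0 | apply/HS1].
have Seq : is_equivalence S.
{ apply: equivalence_related => A.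
  - by move=> x; apply/SE; split; apply: reflexive_related; case: HR.
  - by move=> x y /SE [H0 H1]; apply/SE; split; exact: symmetric_related.
  - move=> x y z /SE [H0 H1] /SE [K0 K1]; apply/SE.
    by split; [exact: (transitive_related HR H0 K0)
              | exact: (transitive_related HR H1 K1)]. }
have u'mono : is_mono u'.
  move=> A a b e; apply: (proj1 Hu).
  by rewrite -u0 -!compA e.
have u'normal : normal_to u' S.
{ apply: normal_toI => // A a.
  - move=> b; apply/SE; rewrite !compA u0 u1; split; exact: normal_full.
  - move=> y /SE; rewrite !compA u0 u1.
    move=> [/(normal_closed Hu) [b eb] /(normal_closed Hu) [b' eb']].
    have bb' : b = b'.
      by apply: mv; rewrite vE -!compA eb eb' !compA eQ.
    exists b; apply: (@rel_monic _ _ Q).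
      by rewrite compA u0.
    by rewrite compA u1 bb'. }
have [z [_ Hz]] := univ Q S u' (w ∘ d0 Q) Seq u'normal
  ltac:(by rewrite -compA u0).
have [S0map S1map] : rel_map S R (d0 Q) /\ rel_map S R (d1 Q).
  have /SE [H0 H1] := related_legs (idm S).
  by rewrite !compm1 in H0 H1.
have e : d0 Q = d1 Q.
  apply: etrans (Hz (d1 Q) _); last by split.
  by apply: esym; apply: Hz.
move=> A a b /(kernel_pair_related HQ) [r [<- <-]].
by rewrite e.
Qed.

(** A map that is null on [U] is invariant under an equivalence relation to
    which [U] is normal: it is enough to see it on reflexive pairs and on the
    pairs [(0, y)], for which [y] lies in [U]. *)
Lemma normal_invariant (C : category) (U X Y : C) (u : U ~> X)
    (R : relation X) (g : X ~> Y) : pointed C -> protomodular C ->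
  is_equivalence R -> normal_to u R -> null (g ∘ u) ->
  g ∘ d0 R = g ∘ d1 R.
Proof.
move=> pt pm [[i [i0 i1]] _] Hu gu.
apply: (section_kernel_epic pt pm i0); first by rewrite -!compA i0 i1.
move=> T r Hr; have [a Ha] := @null_exists C T U pt.
have ra : d0 R ∘ r = u ∘ a by apply: null_eq => //; exact: null_postcomp.
have [|b eb] := @normal_closed _ _ _ _ _ Hu T a (d1 R ∘ r).
  by exists r.
rewrite -!compA -eb; apply: null_eq; first exact: null_postcomp.
by rewrite compA; exact: null_precomp.
Qed.

(** * Elements with the same action *)

(** For groups, the normalizer of the diagonal copy of [K] in [X * X] is made
    of the pairs [(x0, x1)] that induce the same conjugation on [K].  Two
    cartesian maps that agree on kernels factor through it, since the kernel
    of [p'] is normal to the kernel pair of [p'] and goes to the diagonal. *)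
Lemma diagonal_normalizer (C : category) (p : Pt C) (K : C)
    (k : K ~> pt_dom p) :
  pointed C -> protomodular C -> has_normalizers C ->
  is_kernel k (pt_epi p) ->
  exists (N : relation (pt_dom p)) (R : relation N) (u : K ~> N),
    is_equivalence R /\ normal_to u R /\ d0 N ∘ u = k /\ d1 N ∘ u = k /\
    forall (p' : Pt C) (n0 n1 : p' ~> p), cartesian n0 -> cartesian n1 ->
    (forall (T : C) (x : T ~> pt_dom p'), null (pt_epi p' ∘ x) ->
       pm_dom n0 ∘ x = pm_dom n1 ∘ x) ->
    exists h : pt_dom p' ~> N, d0 N ∘ h = pm_dom n0 /\ d1 N ∘ h = pm_dom n1 /\
      forall (T : C) (x y : T ~> pt_dom p'),
        pt_epi p' ∘ x = pt_epi p' ∘ y -> related R (h ∘ x) (h ∘ y).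
Proof.
move=> pt pm norm Hk; have [fc _] := pm.
have mk := kernel_mono Hk.
have [XX [p0 [p1 HX]]] := @product_exists C (pt_dom p) (pt_dom p) fc.
have [v [v0 v1]] := product_lift HX k k.
have mv : is_mono v.
  by move=> T a b e; apply: mk; rewrite -v0 -!compA e.
have [N [u [R [w HN]]]] := norm _ _ v mv.
have mw := normalizer_mono fc mv HN.
have [HR [Hu [vE univ]]] := HN.
have mN (T : C) (a b : T ~> N) : (p0 ∘ w) ∘ a = (p0 ∘ w) ∘ b ->
    (p1 ∘ w) ∘ a = (p1 ∘ w) ∘ b -> a = b.
  by rewrite -!compA => H0 H1; apply: mw; exact: (product_monic HX).
exists (@Relation C _ N (p0 ∘ w) (p1 ∘ w) mN), R, u.
rewrite /= -!compA -vE; do 4! split=> //.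
move=> p' n0 n1 c0 c1 agree.
have fk := kernel_null Hk.
(* the copy [u'] of [K] in the total object of [p'], as [n0] is cartesian *)
have [o Ho] := @null_exists C K (pt_cod p') pt.
have [|u' [nu' fu']] := @pullback_lift _ _ _ _ _ _ _ _ _ c0 K k o.
  by apply: null_eq => //; exact: null_postcomp.
have nfu' : null (pt_epi p' ∘ u') by rewrite fu'.
have nu'1 : pm_dom n1 ∘ u' = k by rewrite -agree.
have [S HS] := kernel_pair_exists (pt_epi p') fc.
have SE := kernel_pair_related HS.
have Seq : is_equivalence S.
{ apply: equivalence_related => T.
  - by move=> x; apply/SE.
  - by move=> x y /SE e; apply/SE.
  - by move=> x y z /SE e /SE e'; apply/SE; rewrite e. }
have u'normal : normal_to u' S.
{ apply: normal_toI => //.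
  - by move=> T a b e; apply: mk; rewrite -nu' -!compA e.
  - move=> T a b; apply/SE; rewrite !compA.
    by apply: null_eq; exact: null_precomp.
  - move=> T a y /SE; rewrite compA => e.
    have ny : null (pt_epi p' ∘ y) by rewrite -e; exact: null_precomp.
    have [|b eb] := kernel_lift Hk (x := pm_dom n0 ∘ y).
      by rewrite compA pm_epi -compA; exact: null_postcomp.
    exists b; apply: (pullback_monic c0); first by rewrite compA nu'.
    by apply: null_eq => //; rewrite compA; exact: null_precomp. }
have [n [n0E n1E]] := product_lift HX (pm_dom n0) (pm_dom n1).
have [|h [[hw [_ hR]] _]] := univ _ S u' n Seq u'normal.
  apply: (product_monic HX); rewrite compA.
    by rewrite n0E v0 nu'.
  by rewrite n1E v1 nu'1.
exists h; rewrite -!compA hw n0E n1E; do 2! split=> //.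
by move=> T x y /SE; exact: rel_map_related.
Qed.

(** The pairs of elements of the base that act in the same way on the kernel
    of [p] form the base of a cartesian relation on [p], through which any two
    cartesian maps that agree on kernels factor.  Its base [M] is the
    restriction of the diagonal normalizer [N] along the section; its total
    object is the part of [R] that lies over [M], so that its kernel is the
    [R]-class of zero, that is [K]. *)
Lemma same_action_relation (C : category) (p : Pt C) :
  pointed C -> protomodular C -> has_normalizers C ->
  exists D : relation p, rel_reflexive D /\ cartesian (d0 D) /\
    forall (p' : Pt C) (n0 n1 : p' ~> p), cartesian n0 -> cartesian n1 ->
    (forall (T : C) (x : T ~> pt_dom p'), null (pt_epi p' ∘ x) ->
       pm_dom n0 ∘ x = pm_dom n1 ∘ x) ->
    exists y, pm_cod (d0 D) ∘ y = pm_cod n0 /\ pm_cod (d1 D) ∘ y = pm_cod n1.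
Proof.
move=> pt pm norm; have [fc _] := pm.
have [K [k Hk]] := kernel_exists (pt_epi p) fc pt.
have [N [R [u [HR [Hu [u0 [u1 univ]]]]]]] := diagonal_normalizer pt pm norm Hk.
have fk := kernel_null Hk.
have [M ME] := inverse_image_exists N (pt_sec p) fc.
have [s [s0 s1]] : related N (pt_sec p ∘ d0 M) (pt_sec p ∘ d1 M).
  by have /ME := related_legs (idm M); rewrite !compm1.
have [P [pi [rho HP]]] := proj2 fc _ _ _ s (d0 R).
have [eP _] := HP.
have [[i [i0 i1]] _] := HR.
have [|t [t0 t1]] := @pullback_lift _ _ _ _ _ _ _ _ _ HP M (idm M) (i ∘ s).
  by rewrite compA i0 compm1 comp1m.
pose P' : Pt C := Point t0.
have inv (w : N ~> pt_dom p) (d : M ~> pt_cod p) : w ∘ u = k ->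
    w ∘ s = pt_sec p ∘ d -> pt_epi p ∘ (w ∘ d1 R ∘ rho) = d ∘ pi.
  move=> wu ws.
  have e : (pt_epi p ∘ w) ∘ d0 R = (pt_epi p ∘ w) ∘ d1 R.
    by apply: (normal_invariant pt pm HR Hu); rewrite -compA wu.
  rewrite !compA -e -!compA -eP [w ∘ _]compA ws !compA pt_split comp1m //.
have sec (w : N ~> pt_dom p) (d : M ~> pt_cod p) : w ∘ s = pt_sec p ∘ d ->
    (w ∘ d1 R ∘ rho) ∘ t = pt_sec p ∘ d.
  by move=> <-; rewrite -!compA t1 (comp_absorb _ i1) comp1m.
pose e0 : P' ~> p :=
  @PointMap C P' p (d0 N ∘ d1 R ∘ rho) (d0 M) (inv _ _ u0 s0) (sec _ _ s0).
pose e1 : P' ~> p :=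
  @PointMap C P' p (d1 N ∘ d1 R ∘ rho) (d1 M) (inv _ _ u1 s1) (sec _ _ s1).
have zero T (r : T ~> R) : null (d0 R ∘ r) -> exists b, d1 R ∘ r = u ∘ b.
  move=> nr; have [o no] := @null_exists C T K pt.
  have [|b <-] := @normal_closed _ _ _ _ _ Hu T o (d1 R ∘ r); last by exists b.
  exists r; split=> //; apply: null_eq => //; exact: null_postcomp.
have c0 : cartesian e0.
{ apply: kernel_bijective_cartesian => //= T.
  - move=> x /(kernel_lift Hk) [a <-].
    have [o no] := @null_exists C T K pt.
    have [z nz] := @null_exists C T M pt.
    have [r [r0 r1]] := normal_full Hu o a.
    have [|l [l0 l1]] := @pullback_lift _ _ _ _ _ _ _ _ _ HP T z r.
      by rewrite r0; apply: null_eq; exact: null_postcomp.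
    exists l; rewrite l0; split=> //.
    by rewrite -!compA l1 r1 compA u0.
  - move=> a a' na na'; rewrite -!compA => e.
    have [|b Hb] := zero T (rho ∘ a).
      by rewrite -(comp_swap _ eP); exact: null_postcomp.
    have [|b' Hb'] := zero T (rho ∘ a').
      by rewrite -(comp_swap _ eP); exact: null_postcomp.
    have pe : pi ∘ a = pi ∘ a' by exact: null_eq.
    apply: (pullback_monic HP) => //; apply: (@rel_monic _ _ R).
      by rewrite -!(comp_swap _ eP) pe.
    move: e; rewrite Hb Hb' !compA u0 => /(kernel_mono Hk) -> //. }
have mon (T : Pt C) (a b : T ~> P') :
    e0 ∘ a = e0 ∘ b -> e1 ∘ a = e1 ∘ b -> a = b.
  move=> H0 H1.
  have bE : pm_cod a = pm_cod b.
    apply: (@rel_monic _ _ M).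
      exact: (f_equal (@pm_cod _ _ _) H0).
    exact: (f_equal (@pm_cod _ _ _) H1).
  apply: point_map_eq => //; apply: (pullback_monic c0).
    exact: (f_equal (@pm_dom _ _ _) H0).
  by rewrite !pm_epi bE.
have base p' (n0 n1 : p' ~> p) (h : pt_dom p' ~> N) :
    d0 N ∘ h = pm_dom n0 -> d1 N ∘ h = pm_dom n1 ->
    related M (pm_cod n0) (pm_cod n1).
  move=> h0 h1; apply/ME; exists (h ∘ pt_sec p').
  by rewrite !compA h0 h1 !pm_sec.
exists (@Relation (Pt C) p P' e0 e1 mon); split; last split => //.
(* reflexivity: the pair of identities factors through the normalizer *)
- have idc : cartesian (idm p).
    apply: is_pullbackI => /=; first by rewrite compm1 comp1m.
      by move=> T x y; rewrite comp1m => <-; exists x; rewrite comp1m.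
    by move=> T x y; rewrite !comp1m.
  have [h [h0 [h1 hR]]] := univ p (idm p) (idm p) idc idc (fun _ _ _ => erefl).
  have [mu [mu0 mu1]] := base p (idm p) (idm p) h h0 h1.
  rewrite /= in h0 h1 mu0 mu1.
  have smu : s ∘ mu = h ∘ pt_sec p.
    apply: (@rel_monic _ _ N); rewrite !compA.
      by rewrite s0 h0 -compA mu0 compm1 comp1m.
    by rewrite s1 h1 -compA mu1 compm1 comp1m.
  have [|r [r0 r1]] := hR _ (pt_sec p ∘ pt_epi p) (idm _).
    by rewrite compA pt_split comp1m compm1.
  rewrite compm1 in r1.
  have [|x [x0 x1]] := @pullback_lift _ _ _ _ _ _ _ _ _ HP _ (mu ∘ pt_epi p) r.
    by rewrite r0 !compA smu.
  have xs : x ∘ pt_sec p = t ∘ mu.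
    apply: (pullback_monic HP).
      by rewrite !compA x0 t0 -compA pt_split compm1 comp1m.
    rewrite !compA x1 t1; apply: (@rel_monic _ _ R).
      rewrite !compA r0 i0 comp1m smu.
      by rewrite -!compA pt_split compm1.
    by rewrite !compA r1 i1 comp1m smu.
  exists (@PointMap C p P' x mu x0 xs).
  split; apply: point_map_eq => //=.
    by rewrite -!compA x1 r1.
  by rewrite -!compA x1 r1.
- move=> p' n0 n1 cn0 cn1 agree.
  have [h [h0 [h1 _]]] := univ p' n0 n1 cn0 cn1 agree.
  exact: base h0 h1.
Qed.

(** * Action accessibility *)

(** The cover is the object of triples of an element of [p'] and two liftings to
    [p] of its images, as an iterated pullback of [m]; each [n_i] is also a
    base change of [m_i], hence cartesian. *)
Lemma lift_after_cover (C : category) (p' p q : Pt C) (m0 m1 : p' ~> q)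
    (m : p ~> q) : regular_category C ->
  cartesian m0 -> cartesian m1 -> cartesian m -> regular_epi (pm_cod m) ->
  exists (P : Pt C) (c : P ~> p') (n0 n1 : P ~> p),
    m ∘ n0 = m0 ∘ c /\ m ∘ n1 = m1 ∘ c /\
    cartesian n0 /\ cartesian n1 /\ is_epi (pm_cod c).
Proof.
move=> [fc [_ stable]] c0 c1 cm em.
have [P [a [b [[E0 _] [HX HY]]]]] := Pt_pullback m0 m fc.
have [P' [c [e [[E1 _] [HX' HY']]]]] := Pt_pullback (m1 ∘ a) m fc.
have ca : cartesian a := cartesian_base_change HX HY cm.
have cb : cartesian b :=
  cartesian_base_change (pullback_sym HX) (pullback_sym HY) c0.
have cc : cartesian c := cartesian_base_change HX' HY' cm.
exists P', (a ∘ c), (b ∘ c), e; split; last split; last split; last split.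
- exact: (esym (comp_swap c E0)).
- by rewrite compA.
- exact: cartesian_comp.
- apply: (cartesian_base_change (pullback_sym HX') (pullback_sym HY')).
  exact: cartesian_comp.
- apply: epi_comp; apply: regular_epi_epi.
  + exact: (stable _ _ _ _ _ _ _ _ (pullback_sym HY') em).
  + exact: (stable _ _ _ _ _ _ _ _ (pullback_sym HY) em).
Qed.

(** Dividing [p] by the relation of same action yields a faithful point: two
    cartesian maps into the quotient that agree on kernels lift to [p] after
    a cover of their source, where the lifts still agree on kernels because
    the quotient map is injective there; so the base components of the lifts
    are identified in the quotient.  A map of points is then determined by its
    base component and its restriction to the kernel. *)
Lemma exact_action_accessible (C : category) :
  barr_exact C -> pointed C -> protomodular C -> has_normalizers C ->
  action_accessible C.
Proof.
move=> Hex pt pm norm.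
have Hm := protomodular_maltsev pt pm.
split=> //; split=> // p.
have [D [Dr [D0 Dmax]]] := same_action_relation p pt pm norm.
have [q [m [mcart [mD [_ [mY _]]]]]] := cartesian_quotient Hex Hm Dr D0.
exists q, m; split=> //.
move=> p' m0 m1 c0 c1 K' K k' k Hk' _ j0 j1 e0 e1 e01.
have agree T (x : T ~> pt_dom p') : null (pt_epi p' ∘ x) ->
    pm_dom m0 ∘ x = pm_dom m1 ∘ x.
  move=> /(kernel_lift Hk') [x' <-].
  by rewrite !compA -e0 -e1 e01.
have [P [c [n0 [n1 [L0 [L1 [cn0 [cn1 ec]]]]]]]] :=
  lift_after_cover (proj1 Hex) c0 c1 mcart mY.
have L0X : pm_dom m ∘ pm_dom n0 = pm_dom m0 ∘ pm_dom c.
  exact: (f_equal (@pm_dom _ _ _) L0).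
have L1X : pm_dom m ∘ pm_dom n1 = pm_dom m1 ∘ pm_dom c.
  exact: (f_equal (@pm_dom _ _ _) L1).
have L0Y : pm_cod m ∘ pm_cod n0 = pm_cod m0 ∘ pm_cod c.
  exact: (f_equal (@pm_cod _ _ _) L0).
have L1Y : pm_cod m ∘ pm_cod n1 = pm_cod m1 ∘ pm_cod c.
  exact: (f_equal (@pm_cod _ _ _) L1).
have mDY : pm_cod m ∘ pm_cod (d0 D) = pm_cod m ∘ pm_cod (d1 D).
  exact: (f_equal (@pm_cod _ _ _) mD).
have [|y [y0 y1]] := Dmax P n0 n1 cn0 cn1.
  move=> T x nx; apply: (pullback_monic mcart).
    rewrite (comp_swap x L0X) (comp_swap x L1X); apply: agree.
    by rewrite compA pm_epi -compA; exact: null_postcomp.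
  rewrite !compA !pm_epi -!compA.
  by apply: null_eq; exact: null_postcomp.
have codE : pm_cod m0 = pm_cod m1.
  by apply: ec; rewrite -L0Y -L1Y -y0 -y1 !compA mDY.
apply: point_map_eq => //.
apply: (section_kernel_epic pt pm (pt_split p')); last exact: agree.
by rewrite !pm_sec codE.
Qed.

Theorem proposition3p4 :
  (forall C : category,
     barr_exact C -> action_distinctive C -> enough_eccentric C) /\
  (forall C : category,
     barr_exact C -> pointed C -> protomodular C -> has_normalizers C ->
     action_accessible C).
Proof.
split.
- exact: exact_enough_eccentric.
- exact: exact_action_accessible.
Qed.
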